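(* For all real $t>0$ and all integers $k\ge 1$, $$\vartheta(t) = \frac{t}{2} \log\left(\frac{t}{2\pi e}\right) - \frac{\pi}{8} + \frac{\arctan\left(e^{-\pi t}\right)}{2} + \sum_{j=1}^{k-1}\widetilde{T}_j(t) + \widetilde{R}_{k}(t),$$ where $$\widetilde{T}_j(t) := \tfrac12|\widehat{T}_j(t)| = \frac{|B_{2j}(\frac12)|}{4j(2j-1)t^{2j-1}}$$ and $$\widetilde{R}_{k}(t) := \Im\left(\tfrac12\widehat{R}_{k}(it)\right).$$
   Context: The Riemann-Siegel theta function is defined for real $t$ by $\vartheta(t) := \arg\Gamma\left(\frac{it}{2}+\frac14\right) - \frac{t}{2}\log\pi$, where the argument is chosen so that $\vartheta$ is continuous on $\mathbb{R}$ and $\vartheta(0)=0$. $\log$ is the principal branch of the logarithm on $\mathbb{C}\setminus(-\infty,0]$. $\ln\Gamma$ denotes the analytic function on $\mathbb{C}\setminus(-\infty,0]$ with $\exp(\ln\Gamma(z))=\Gamma(z)$ that is real and equal to $\log(\Gamma(x))$ for real $x>0$. $B_{2j}(u)$ is the Bernoulli polynomial. For integers $j\ge 1$, $$\widehat{T}_j(z) = \frac{B_{2j}(\frac12)}{2j(2j-1)z^{2j-1}},$$ and for integers $k\ge 1$ and $z\in\mathbb{C}$ with $\Re(z)\ge0$, $z\neq0$, the remainder $\widehat{R}_k(z)$ is defined by $$\ln\Gamma(z+\tfrac12) = z\log z - z + \tfrac12\log(2\pi) + \sum_{j=1}^{k-1}\widehat{T}_j(z) + \widehat{R}_k(z).$$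 *)

(* Defs.v *)
(* Stdlib reals and Coquelicot complex numbers. *)
From Stdlib Require Import Reals Lra Lia Arith.
From Coquelicot Require Import Coquelicot.

Open Scope R_scope.

Definition Cexp (z : C) : C := (exp (Re z) * cos (Im z), exp (Re z) * sin (Im z)).

(* Principal argument in (-PI, PI]. *)
Definition Carg (z : C) : R :=
  if Rle_dec 0 (Im z) then acos (Re z / Cmod z) else - acos (Re z / Cmod z).

Definition Clog (z : C) : C := (ln (Cmod z), Carg z).

(* C \ (-oo, 0] *)
Definition slit_plane (z : C) : Prop := 0 < Re z \/ Im z <> 0.

(* z (z + 1) ... (z + n - 1) *)
Fixpoint rising (z : C) (n : nat) : C :=
  match n with
  | O => RtoC 1
  | S m => (rising z m * (z + RtoC (INR m)))%C
  end.

(* Euler's limit  Gamma(z) = lim n! n^z / (z (z+1) ... (z+n)),  which converges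
   at every z outside 0, -1, -2, ...; the limit is taken on real and imaginary
   parts.  The value at n = 0 is irrelevant. *)
Definition gamma_seq (z : C) (n : nat) : C :=
  (RtoC (INR (fact n)) * Cexp (z * RtoC (ln (INR n))) / rising z (S n))%C.

Definition Gamma (z : C) : C :=
  (real (Lim_seq (fun n => Re (gamma_seq z n))),
   real (Lim_seq (fun n => Im (gamma_seq z n)))).

(* These conditions determine the function on the slit plane; its values
   elsewhere are left arbitrary.  Analyticity is complex differentiability at
   every point of the open set. *)
Record is_lnGamma (L : C -> C) : Prop := {
  lnGamma_holomorphic : forall z : C, slit_plane z ->
    @ex_derive C_AbsRing C_NormedModule L z;
  lnGamma_exp : forall z : C, slit_plane z -> Cexp (L z) = Gamma z;
  lnGamma_real : forall x : R, 0 < x ->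
    Im (L (RtoC x)) = 0 /\ L (RtoC x) = Clog (Gamma (RtoC x))
}.

Definition is_argument (w : C) (phi : R) : Prop :=
  w = (RtoC (Cmod w) * Cexp (Ci * RtoC phi))%C.

Record is_RS_theta (theta : R -> R) : Prop := {
  theta_continuous : forall t : R, continuous theta t;
  theta_0 : theta 0 = 0;
  theta_argument : forall t : R,
    is_argument (Gamma (Ci * RtoC t / RtoC 2 + RtoC (1 / 4)))%C
                (theta t + t / 2 * ln PI)
}.

(* Values of B_0(u), ..., B_n(u) at the indices 0, ..., n, from
   B_n(u) = u^n - (1/(n+1)) sum_(k < n) binom(n+1, k) B_k(u). *)
Fixpoint bernoulli_upto (u : R) (n : nat) : nat -> R :=
  match n with
  | O => fun _ => 1
  | S m => fun i =>
      if (i <=? m)%nat then bernoulli_upto u m i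
      else u ^ S m
           - / INR (S (S m))
             * sum_f_R0 (fun k => Binomial.C (S (S m)) k * bernoulli_upto u m k) m
  end.

(* The Bernoulli polynomial B_n evaluated at u. *)
Definition bernoulli (n : nat) (u : R) : R := bernoulli_upto u n n.

Lemma bernoulli_upto_le (u : R) (n i : nat) :
  (i <= n)%nat -> bernoulli_upto u n i = bernoulli i u.
Proof.
induction n as [|n IH]; intros Hi.
- now replace i with O by lia.
- destruct (Nat.eq_dec i (S n)) as [->|Hne]; [reflexivity|].
  cbn [bernoulli_upto].
  destruct (Nat.leb_spec i n); [now apply IH | lia].
Qed.

Lemma bernoulli_rec (n : nat) (u : R) :
  sum_f_R0 (fun k => Binomial.C (S n) k * bernoulli k u) n = INR (S n) * u ^ n.
Proof.
destruct n as [|m].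
- cbn -[Binomial.C]. unfold bernoulli; cbn -[Binomial.C].
  rewrite pascal_step2, C_n_0 by lia. simpl. field.
- rewrite tech5.
  assert (HB : bernoulli (S m) u =
    u ^ S m - / INR (S (S m))
      * sum_f_R0 (fun k => Binomial.C (S (S m)) k * bernoulli k u) m).
  { unfold bernoulli at 1. cbn [bernoulli_upto].
    destruct (Nat.leb_spec (S m) m); [lia|].
    do 2 f_equal. apply sum_eq. intros i Hi.
    now rewrite bernoulli_upto_le. }
  rewrite HB.
  rewrite (pascal_step2 (S m) (S m)), C_n_n by lia.
  replace (S (S m) - S m)%nat with 1%nat by lia.
  assert (INR (S (S m)) <> 0) by (apply not_0_INR; lia).
  simpl (INR 1). field. assumption.
Qed.

Definition That (j : nat) (z : C) : C :=
  (RtoC (bernoulli (2 * j) (1 / 2))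
   / (RtoC (INR (2 * j)) * RtoC (INR (2 * j - 1)) * z ^ (2 * j - 1)))%C.

(* Meaningful for k >= 1, Re z >= 0 and z <> 0.  The sum over 1 <= j <= k - 1
   is empty for k = 1. *)
Definition Rhat (lnGamma : C -> C) (k : nat) (z : C) : C :=
  (lnGamma (z + RtoC (1 / 2))
   - (z * Clog z - z + RtoC (ln (2 * PI) / 2)
      + sum_n_m (fun j => That j z) 1 (k - 1)))%C.

Definition Ttilde (j : nat) (t : R) : R := / 2 * Cmod (That j (RtoC t)).

Definition Rtilde (lnGamma : C -> C) (k : nat) (t : R) : R :=
  Im (RtoC (/ 2) * Rhat lnGamma k (Ci * RtoC t))%C.

(* Main.v *)
Require Import Defs.
From Stdlib Require Import Reals Arith Lra Lia.
From Coquelicot Require Import Coquelicot.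

Open Scope R_scope.

(** The correction terms are chosen so that they cancel.  On the imaginary axis
    each Stirling term has imaginary part [Im (That j (i t)) = 2 * Ttilde j t],
    because [i^(2j-1) = -(-1)^j i] and [B_(2j)(1/2)] has sign [(-1)^j]
    ([bernoulli_signs], [Im_That_imaginary]).  Hence the sum of the [Ttilde j t]
    disappears against the one hidden in [Rtilde], whatever [k] is, and what
    remains is an exact identity between arguments ([theta_lnGamma]):

      theta t = Im (lnGamma (1/2 + i t)) / 2 - (t/2) ln (2 pi) - pi/8
                + atan (exp (- pi t)) / 2.

    Modulo [2 pi], twice this identity says how the arguments of
    Gamma(1/4 + i t/2) and Gamma(1/2 + i t) are related.  It follows from the
    duplication formula for Gamma(z) Gamma(z + 1/2) and the reflection formula
    for Gamma(z) Gamma(1 - z) at z = 1/4 + i t/2, since 1 - z is the conjugate of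
    z + 1/2.  Only arguments matter, so both formulas are proved for arguments
    alone.  Writing Euler's product in polar form, its n-th term at a + i b has
    the argument

      gamma_arg a b n = b ln n - sum_(k <= n) atan (b / (a + k)),

    and both this and the logarithm of the modulus converge ([Gamma_polar]).
    Duplication is then an identity between finite sums, in which the terms for
    1/4 and 3/4 interleave to those for 1/2.  Reflection is the evaluation of
    sum_k (atan (2t/(4k+1)) - atan (2t/(4k+3))) as atan (tanh (pi t / 2))
    ([atan_pairs_lim]), the argument of the sine product at pi/4 + i pi t/2.  This
    comes from iterating the half-angle identity [tanh_cot_halve], which writes
    atan (tanh (pi t / 2)) as a finite sum of the same shape, and letting the
    mesh tend to 0.

    Finally, the difference of the two sides is continuous and vanishes at
    [t = 0], and a continuous function with values in the multiples of [2 pi] is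
    constant ([continuous_cos_1_eq_0]). *)

(** * Mean value theorem and finite sums *)

Lemma ex_derive_continuity_pt (f : R -> R) (x : R) :
  ex_derive f x -> continuity_pt f x.
Proof.
intros H; apply continuity_pt_filterlim, (ex_derive_continuous f), H.
Qed.

Lemma mean_value (f df : R -> R) (a b : R) :
  (forall x, is_derive f x (df x)) ->
  exists c, Rmin a b <= c <= Rmax a b /\ f b - f a = df c * (b - a).
Proof.
intros Hf; apply (MVT_gen f a b df).
- intros; apply Hf.
- intros z _; apply ex_derive_continuity_pt.
  eexists; apply Hf.
Qed.

Lemma mean_value_le (f df : R -> R) (a b : R) :
  (forall x, is_derive f x (df x)) -> a <= b ->
  exists c, a <= c <= b /\ f b - f a = df c * (b - a).
Proof.
intros Hf Hab; destruct (mean_value f df a b Hf) as [c [Hc E]].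
rewrite Rmin_left, Rmax_right in Hc by assumption; eauto.
Qed.

Lemma is_derive_0_const (f : R -> R) :
  (forall x, is_derive f x 0) -> forall x y, f x = f y.
Proof.
intros Hf x y.
destruct (mean_value f (fun _ => 0) x y Hf) as [c [_ Hc]]; lra.
Qed.

(** The bound is exclusive, so that a range of even length splits in pairs or in
    halves without shifting any index. *)
Fixpoint psum (f : nat -> R) (n : nat) : R :=
  match n with
  | O => 0
  | S m => psum f m + f m
  end.

Lemma psum_ext (f g : nat -> R) (n : nat) :
  (forall k, (k < n)%nat -> f k = g k) -> psum f n = psum g n.
Proof.
induction n as [|n IH]; intros H; [reflexivity|].
cbn [psum]; rewrite IH, H by auto with arith; reflexivity.
Qed.

Lemma psum_plus (f g : nat -> R) (n : nat) :
  psum (fun k => f k + g k) n = psum f n + psum g n.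
Proof. induction n as [|n IH]; cbn [psum]; [|rewrite IH]; ring. Qed.

Lemma psum_minus (f g : nat -> R) (n : nat) :
  psum (fun k => f k - g k) n = psum f n - psum g n.
Proof. induction n as [|n IH]; cbn [psum]; [|rewrite IH]; ring. Qed.

Lemma psum_double (f : nat -> R) (n : nat) :
  psum (fun k => f (2 * k)%nat + f (2 * k + 1)%nat) n = psum f (2 * n).
Proof.
induction n as [|n IH]; [reflexivity|].
replace (2 * S n)%nat with (S (S (2 * n))) by lia.
cbn [psum]; rewrite IH.
replace (2 * n + 1)%nat with (S (2 * n)) by lia; ring.
Qed.

Lemma psum_add (f : nat -> R) (m n : nat) :
  psum f (m + n) = psum f m + psum (fun k => f (m + k)%nat) n.
Proof.
induction n as [|n IH]; [rewrite Nat.add_0_r; simpl; ring|].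
rewrite Nat.add_succ_r; cbn [psum]; rewrite IH; ring.
Qed.

Lemma psum_rev (f : nat -> R) (n : nat) :
  psum f n = psum (fun k => f (n - 1 - k)%nat) n.
Proof.
induction n as [|n IH]; [reflexivity|].
transitivity (psum (fun k => f (S n - 1 - k)%nat) (1 + n)); [|reflexivity].
rewrite psum_add; cbn [psum]; rewrite IH.
replace (S n - 1 - 0)%nat with n by lia.
rewrite (psum_ext (fun k => f (S n - 1 - (1 + k))%nat)
                  (fun k => f (n - 1 - k)%nat)); [ring|].
intros k Hk; f_equal; lia.
Qed.

Lemma psum_lim (u : nat -> nat -> R) (l : nat -> R) (n : nat) :
  (forall k, (k < n)%nat -> is_lim_seq (fun m => u m k) (l k)) ->
  is_lim_seq (fun m => psum (u m) n) (psum l n).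
Proof.
induction n as [|n IH]; intros H; cbn [psum]; [apply is_lim_seq_const|].
apply is_lim_seq_plus'; [apply IH; intros; apply H|apply H]; lia.
Qed.

(** * Bernoulli polynomials and the sign of their values at 1/2 *)

Lemma bernoulli_S (m : nat) (u : R) :
  bernoulli (S m) u =
  u ^ S m - / INR (S (S m))
            * sum_f_R0 (fun k => Binomial.C (S (S m)) k * bernoulli k u) m.
Proof.
assert (Hrec := bernoulli_rec (S m) u).
rewrite tech5, (pascal_step2 (S m) (S m)), C_n_n in Hrec by lia.
replace (S (S m) - S m)%nat with 1%nat in Hrec by lia.
assert (INR (S (S m)) <> 0) by (apply not_0_INR; lia).
simpl (INR 1) in Hrec.
set (s := sum_f_R0 _ _) in *.
replace s with (INR (S (S m)) * u ^ S m
                - INR (S (S m)) / 1 * 1 * bernoulli (S m) u) by lra.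
field; assumption.
Qed.

Lemma binomial_absorption (n i : nat) :
  (i <= n)%nat ->
  Binomial.C (S n) (S i) * INR (S i) = INR (S n) * Binomial.C n i.
Proof.
intros Hi; unfold Binomial.C.
replace (S n - S i)%nat with (n - i)%nat by lia.
rewrite !fact_simpl, !mult_INR.
field; repeat split; try apply INR_fact_neq_0; apply not_0_INR; lia.
Qed.

(** Differentiating the recurrence for [B_(m+1)] gives, by absorption, a multiple
    of the recurrence for [B_m]. *)
Lemma bernoulli_is_derive (n : nat) (u : R) :
  is_derive (bernoulli n) u (INR n * bernoulli (pred n) u).
Proof.
revert u; induction n as [[|m] IH] using lt_wf_ind; intros u.
- apply is_derive_ext with (fun _ => 1); [reflexivity|].
  simpl (INR 0); rewrite Rmult_0_l; apply @is_derive_const.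
- apply is_derive_ext with (fun v => v ^ S m - / INR (S (S m)) *
    sum_n (fun k => Binomial.C (S (S m)) k * bernoulli k v) m).
  { intros v; rewrite sum_n_Reals; symmetry; apply bernoulli_S. }
  assert (HN : INR (S (S m)) <> 0) by (apply not_0_INR; lia).
  replace (INR (S m) * bernoulli (pred (S m)) u) with
    (INR (S m) * 1 * u ^ m - / INR (S (S m)) *
      sum_n (fun k => Binomial.C (S (S m)) k
                      * (INR k * bernoulli (pred k) u)) m).
  + apply @is_derive_minus.
    { apply is_derive_pow, @is_derive_id. }
    apply is_derive_scal, (is_derive_sum_n
      (fun k v => Binomial.C (S (S m)) k * bernoulli k v)).
    intros k Hk; apply is_derive_scal, IH; lia.
  + rewrite sum_n_Reals; simpl pred; destruct m as [|p].
    { simpl; rewrite Rmult_0_l, !Rmult_0_r. unfold bernoulli; simpl; ring. }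
    rewrite decomp_sum by lia; simpl pred.
    rewrite (sum_eq _ (fun i => Binomial.C (S (S p)) i * bernoulli i u
                                * INR (S (S (S p))))).
    2:{ intros i Hi; simpl pred.
        assert (Ha := binomial_absorption (S (S p)) i ltac:(lia)).
        rewrite <- Rmult_assoc, Ha; ring. }
    rewrite <- scal_sum, (bernoulli_S p).
    assert (INR (S (S p)) <> 0) by (apply not_0_INR; lia).
    simpl (INR 0); field; split; assumption.
Qed.

(** By the recurrence, the differences [d_k = B_k(1) - B_k(0)] satisfy
    sum_(k <= n) binom(n+1, k) d_k = n + 1 for n >= 1; the term k = 1 alone
    gives the right-hand side, which leaves nothing for the later ones. *)
Lemma bernoulli_1_sub_0 (n : nat) :
  bernoulli n 1 - bernoulli n 0 = if (n =? 1)%nat then 1 else 0.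
Proof.
induction n as [[|m] IH] using lt_wf_ind; [unfold bernoulli; simpl; ring|].
rewrite !bernoulli_S, pow1, pow_i by lia.
assert (HN : INR (S (S m)) <> 0) by (apply not_0_INR; lia).
set (s1 := sum_f_R0 _ m); set (s0 := sum_f_R0 _ m).
assert (Hs : s1 - s0 = if (m =? 0)%nat then 0 else INR (S (S m))).
{ unfold s1, s0; rewrite <- minus_sum.
  rewrite (sum_eq _ (fun k => if (k =? 1)%nat then INR (S (S m)) else 0)).
  - clear; generalize (INR (S (S m))) as c; intros c.
    destruct m as [|m]; [reflexivity|].
    induction m as [|m IHm]; [simpl; ring|].
    rewrite tech5, IHm; simpl; ring.
  - intros k Hk; rewrite <- Rmult_minus_distr_l, IH by lia.
    destruct (Nat.eqb_spec k 1) as [->|]; [|ring].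
    assert (Ha := binomial_absorption (S m) 0 ltac:(lia)).
    rewrite C_n_0 in Ha; change (INR 1) with 1 in Ha; lra. }
replace s1 with (s0 + (s1 - s0)) by ring; rewrite Hs.
destruct m as [|m]; simpl (_ =? _)%nat; cbv iota; field; assumption.
Qed.

(** Both sides satisfy the same derivative rule, so the defect [e n] of the
    identity is constant if [e (n-1)] vanishes; equal values of [e (n+1)] at 0
    and 1 force that constant to be 0. *)
Lemma bernoulli_reflect (n : nat) (u : R) :
  bernoulli n (1 - u) = (-1) ^ n * bernoulli n u.
Proof.
revert u; induction n as [|n IH]; [intros; unfold bernoulli; simpl; ring|].
pose (e := fun m v => bernoulli m (1 - v) - (-1) ^ m * bernoulli m v).
assert (De : forall m v, is_derive (e (S m)) v (- INR (S m) * e m v)).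
{ intros m v; unfold e.
  replace (- INR (S m) * (bernoulli m (1 - v) - (-1) ^ m * bernoulli m v))
    with ((-1) * (INR (S m) * bernoulli (pred (S m)) (1 - v))
          - (-1) ^ S m * (INR (S m) * bernoulli (pred (S m)) v))
    by (simpl pred; simpl pow; ring).
  apply @is_derive_minus; [|apply is_derive_scal, bernoulli_is_derive].
  apply (is_derive_comp (bernoulli (S m)) (fun v => 1 - v));
    [apply bernoulli_is_derive|].
  auto_derive; [exact I|ring]. }
assert (Hconst : forall v, e (S n) v = e (S n) 0).
{ intros v; apply is_derive_0_const; intros x.
  replace 0 with (- INR (S n) * e n x); [apply De|].
  unfold e; rewrite IH; ring. }
destruct (mean_value (e (S (S n))) (fun v => - INR (S (S n)) * e (S n) v) 0 1)
  as [c [_ Hc]]; [intros; apply De|].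
assert (He : e (S (S n)) 1 - e (S (S n)) 0 = 0).
  { assert (H := bernoulli_1_sub_0 (S (S n))); simpl (_ =? _)%nat in H.
    cbv iota in H; unfold e; rewrite Rminus_0_r, Rminus_diag.
    transitivity (- (1 + (-1) ^ S (S n))
                  * (bernoulli (S (S n)) 1 - bernoulli (S (S n)) 0)); [ring|].
    rewrite H; ring. }
  rewrite He, Hconst in Hc.
  assert (Hpos : 0 < INR (S (S n))) by (apply lt_0_INR; lia).
  assert (H0 : e (S n) 0 = 0) by nra.
  intros u; specialize (Hconst u); rewrite H0 in Hconst; unfold e in Hconst; lra.
Qed.

Lemma pow_m1_odd (j : nat) : (-1) ^ (2 * j + 1) = -1.
Proof. rewrite pow_add, pow_1_even; ring. Qed.

Lemma bernoulli_odd_half (j : nat) : bernoulli (2 * j + 1) (1 / 2) = 0.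
Proof.
assert (H := bernoulli_reflect (2 * j + 1) (1 / 2)).
replace (1 - 1 / 2) with (1 / 2) in H by field.
rewrite pow_m1_odd in H; lra.
Qed.

Lemma bernoulli_odd_0 (j : nat) : (1 <= j)%nat -> bernoulli (2 * j + 1) 0 = 0.
Proof.
intros Hj; assert (H := bernoulli_reflect (2 * j + 1) 0).
rewrite Rminus_0_r, pow_m1_odd in H.
assert (H1 := bernoulli_1_sub_0 (2 * j + 1)).
destruct (Nat.eqb_spec (2 * j + 1) 1); [lia|lra].
Qed.

(** The odd polynomials vanish at both ends of [0, 1/2] (except for [B_1]), and
    their signs propagate: if [(-1)^j B_(2j+1) <= 0] there, then
    [E = (-1)^(j+1) B_(2j+2)] is nondecreasing; since it is up to a positive
    factor the derivative of [O = (-1)^(j+1) B_(2j+3)], which vanishes at both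
    ends, it has a zero.  So [E] is nonnegative at 1/2, and [O] first decreases
    and then increases, hence is nonpositive. *)
Lemma bernoulli_signs (j : nat) :
  (forall u, 0 <= u <= 1 / 2 -> (-1) ^ j * bernoulli (2 * j + 1) u <= 0) /\
  0 <= (-1) ^ j * bernoulli (2 * j) (1 / 2).
Proof.
induction j as [|j [IHodd _]].
{ split; [intros u Hu|]; unfold bernoulli; simpl.
  - unfold Binomial.C; simpl; field_simplify; lra.
  - lra. }
pose (E := fun u => (-1) ^ S j * bernoulli (2 * S j) u).
pose (O := fun u => (-1) ^ S j * bernoulli (2 * S j + 1) u).
pose (O' := fun u => (-1) ^ j * bernoulli (2 * j + 1) u).
assert (DE : forall u, is_derive E u (- INR (2 * S j) * O' u)).
{ intros u; unfold E, O'.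
  replace (- INR (2 * S j) * ((-1) ^ j * bernoulli (2 * j + 1) u)) with
    ((-1) ^ S j * (INR (2 * S j) * bernoulli (pred (2 * S j)) u)).
  - apply is_derive_scal, bernoulli_is_derive.
  - replace (pred (2 * S j)) with (2 * j + 1)%nat by lia; simpl pow; ring. }
assert (DO : forall u, is_derive O u (INR (2 * S j + 1) * E u)).
{ intros u; unfold E, O.
  replace (INR (2 * S j + 1) * ((-1) ^ S j * bernoulli (2 * S j) u)) with
    ((-1) ^ S j * (INR (2 * S j + 1) * bernoulli (pred (2 * S j + 1)) u)).
  - apply is_derive_scal, bernoulli_is_derive.
  - replace (pred (2 * S j + 1)) with (2 * S j)%nat by lia; ring. }
assert (Einc : forall u v, 0 <= u -> u <= v -> v <= 1 / 2 -> E u <= E v).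
{ intros u v Hu Huv Hv.
  destruct (mean_value_le E _ u v DE Huv) as [c [Hc H]].
  assert (HO : O' c <= 0) by (apply IHodd; lra).
  assert (0 <= INR (2 * S j)) by apply pos_INR.
  assert (0 <= - INR (2 * S j) * O' c) by nra. nra. }
assert (O0 : O 0 = 0) by (unfold O; rewrite bernoulli_odd_0 by lia; ring).
assert (Oh : O (1 / 2) = 0) by (unfold O; rewrite bernoulli_odd_half; ring).
assert (HN : 0 < INR (2 * S j + 1)) by (apply lt_0_INR; lia).
destruct (mean_value_le O _ 0 (1 / 2) DO) as [x [Hx Ex]]; [lra|].
assert (Ex0 : E x = 0) by nra.
split.
- intros u Hu; change (O u <= 0).
  destruct (Rle_lt_dec u x) as [Hux|Hxu].
  + destruct (mean_value_le O _ 0 u DO) as [c [Hc H]]; [lra|].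
    assert (E c <= E x) by (apply Einc; lra).
    assert (INR (2 * S j + 1) * E c <= 0) by nra. nra.
  + destruct (mean_value_le O _ u (1 / 2) DO) as [c [Hc H]]; [lra|].
    assert (E x <= E c) by (apply Einc; lra).
    assert (0 <= INR (2 * S j + 1) * E c) by nra. nra.
- change (0 <= E (1 / 2)). assert (E x <= E (1 / 2)) by (apply Einc; lra). lra.
Qed.

(** * Polar form of Euler's product and its convergence *)

Definition polar (r phi : R) : C := (r * cos phi, r * sin phi).

Lemma polar_mul (r s phi psi : R) :
  (polar r phi * polar s psi)%C = polar (r * s) (phi + psi).
Proof.
unfold polar; rewrite cos_plus, sin_plus.
apply injective_projections; simpl; ring.
Qed.

Lemma polar_div (r s phi psi : R) :
  s <> 0 -> (polar r phi / polar s psi)%C = polar (r / s) (phi - psi).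
Proof.
intros Hs; unfold polar; rewrite cos_minus, sin_minus.
assert (H : (s * cos psi) ^ 2 + (s * sin psi) ^ 2 = s ^ 2).
{ assert (H := sin2_cos2 psi); unfold Rsqr in H. nra. }
apply injective_projections; simpl in *; rewrite H; field; assumption.
Qed.

Lemma polar_atan (x y : R) :
  0 < x -> (x, y) = polar (sqrt (x ^ 2 + y ^ 2)) (atan (y / x)).
Proof.
intros Hx.
assert (Hs : sqrt (x ^ 2 + y ^ 2) = x * sqrt (1 + (y / x)²)).
{ rewrite <- (sqrt_Rsqr x) at 2 by lra.
  rewrite <- sqrt_mult.
  - f_equal; unfold Rsqr; field; lra.
  - apply Rle_0_sqr.
  - generalize (Rle_0_sqr (y / x)); lra. }
assert (0 < sqrt (1 + (y / x)²)).
{ apply sqrt_lt_R0; generalize (Rle_0_sqr (y / x)); lra. }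
unfold polar; rewrite Hs, cos_atan, sin_atan.
apply injective_projections; simpl; field; lra.
Qed.

Lemma Cmod_polar (r phi : R) : 0 <= r -> Cmod (polar r phi) = r.
Proof.
intros Hr; unfold Cmod, polar; simpl.
replace (_ + _) with (r ^ 2); [apply sqrt_pow2; assumption|].
assert (H := sin2_cos2 phi); unfold Rsqr in H; nra.
Qed.

(** The logarithm of the modulus of Euler's product at a + i b. *)
Definition gamma_log (a b : R) (n : nat) : R :=
  ln (INR (fact n)) + a * ln (INR n)
  - psum (fun k => ln ((a + INR k) ^ 2 + b ^ 2) / 2) (S n).

(** The choice of the argument of Euler's product at a + i b, for a > 0, that is
    continuous in b and vanishes at b = 0. *)
Definition gamma_arg (a b : R) (n : nat) : R :=
  b * ln (INR n) - psum (fun k => atan (b / (a + INR k))) (S n).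

Lemma rising_polar (a b : R) (n : nat) :
  0 < a ->
  rising (a, b) n
  = polar (exp (psum (fun k => ln ((a + INR k) ^ 2 + b ^ 2) / 2) n))
          (psum (fun k => atan (b / (a + INR k))) n).
Proof.
intros Ha; induction n as [|n IH]; cbn [rising psum].
- unfold polar; rewrite exp_0, cos_0, sin_0.
  apply injective_projections; simpl; ring.
- rewrite IH.
  assert (Hn : 0 <= INR n) by apply pos_INR.
  assert (Hp : 0 < (a + INR n) ^ 2 + b ^ 2) by nra.
  replace ((a, b) + RtoC (INR n))%C with (a + INR n, b)
    by (apply injective_projections; simpl; ring).
  rewrite (polar_atan (a + INR n) b) by lra.
  rewrite polar_mul, exp_plus; f_equal; f_equal.
  rewrite <- Rpower_sqrt by assumption.
  unfold Rpower; f_equal; field.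
Qed.

Lemma gamma_seq_polar (a b : R) (n : nat) :
  0 < a ->
  gamma_seq (a, b) n = polar (exp (gamma_log a b n)) (gamma_arg a b n).
Proof.
intros Ha; unfold gamma_seq, gamma_log, gamma_arg.
rewrite rising_polar by assumption.
replace (RtoC (INR (fact n)) * Cexp ((a, b) * RtoC (ln (INR n))))%C
  with (polar (exp (ln (INR (fact n)) + a * ln (INR n))) (b * ln (INR n))).
- rewrite polar_div by apply Rgt_not_eq, exp_pos; f_equal.
  set (s := psum _ _); set (r := _ + _).
  unfold Rminus; rewrite (exp_plus r), exp_Ropp; reflexivity.
- rewrite exp_plus, exp_ln by apply INR_fact_lt_0.
  unfold polar, Cexp; apply injective_projections; simpl;
  rewrite !Rmult_0_r, ?Rplus_0_l, ?Rplus_0_r, ?Rminus_0_r;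
  rewrite Rmult_0_l; ring.
Qed.

(** Adding or subtracting [c / n] makes the sequence monotone.  The bound in
    telescoping form spares the summation of a series of order [1 / n^2]. *)
Lemma ex_lim_telescoping (u : nat -> R) (c : R) :
  (forall n, (1 <= n)%nat ->
     Rabs (u (S n) - u n) <= c * (/ INR n - / INR (S n))) ->
  exists l : R, is_lim_seq u l.
Proof.
intros Hu.
assert (Hpos : forall n, 0 < / INR (S n))
  by (intros n; apply Rinv_0_lt_compat, lt_0_INR; lia).
assert (Hstep : forall n, - (c * (/ INR (S n) - / INR (S (S n))))
   <= u (S (S n)) - u (S n) <= c * (/ INR (S n) - / INR (S (S n)))).
{ intros n; apply Rabs_le_between, Hu; lia. }
assert (Hc : 0 <= c).
{ assert (H := Rabs_pos (u 2%nat - u 1%nat)).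
  assert (H' := Hu 1%nat ltac:(lia)); simpl in H'.
  replace (/ (1 + 1)) with (1 / 2) in H' by field. rewrite Rinv_1 in H'. lra. }
assert (Hlow : forall n, u 1%nat - c <= u (S n) - c * / INR (S n)).
{ induction n as [|n IH]; [simpl; rewrite Rinv_1; lra|].
  specialize (Hstep n); lra. }
destruct (ex_finite_lim_seq_decr (fun n => u (S n) + c * / INR (S n))
            (u 1%nat - c)) as [l Hl].
- intros n; specialize (Hstep n); lra.
- intros n; specialize (Hlow n).
  assert (0 <= c * / INR (S n)) by (apply Rmult_le_pos; [lra|apply Rlt_le, Hpos]).
  lra.
- exists l; apply is_lim_seq_incr_1.
  apply is_lim_seq_ext with
    (fun n => (u (S n) + c * / INR (S n)) - c * / INR (S n)); [intros; ring|].
  replace l with (l - c * 0) by ring.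
  apply is_lim_seq_minus'; [exact Hl|].
  apply (is_lim_seq_scal_l _ c 0).
  apply (is_lim_seq_incr_1 (fun n => / INR n)).
  replace (Finite 0) with (Rbar_inv p_infty) by reflexivity.
  apply is_lim_seq_inv; [apply is_lim_seq_INR|discriminate].
Qed.

Lemma ln_le_sub_1 (x : R) : 0 < x -> ln x <= x - 1.
Proof.
intros Hx; assert (H := exp_ineq1_le (ln x)).
rewrite exp_ln in H by assumption; lra.
Qed.

Lemma ln_ge_1_sub_inv (x : R) : 0 < x -> 1 - / x <= ln x.
Proof.
intros Hx; assert (H := ln_le_sub_1 (/ x) ltac:(now apply Rinv_0_lt_compat)).
rewrite ln_Rinv in H by assumption; lra.
Qed.

Lemma ln_INR_S_bounds (n : nat) :
  (1 <= n)%nat -> / INR (S n) <= ln (INR (S n)) - ln (INR n) <= / INR n.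
Proof.
intros Hn.
assert (H : 0 < INR n) by (apply lt_0_INR; lia).
rewrite <- ln_div by (rewrite ?S_INR; lra).
assert (Hq : 0 < INR (S n) / INR n)
  by (apply Rdiv_lt_0_compat; rewrite ?S_INR; lra).
assert (H1 := ln_le_sub_1 _ Hq); assert (H2 := ln_ge_1_sub_inv _ Hq).
rewrite S_INR in *; split.
- replace (/ (INR n + 1)) with (1 - / ((INR n + 1) / INR n)) by (field; lra).
  exact H2.
- replace (/ INR n) with ((INR n + 1) / INR n - 1) by (field; lra).
  exact H1.
Qed.

Lemma atan_sub_id_bound (x : R) : Rabs (atan x - x) <= x ^ 2.
Proof.
destruct (mean_value (fun y => atan y - y) (fun y => / (1 + y²) - 1) 0 x)
  as [c [Hc E]].
- intros y; auto_derive; [exact I|unfold Rsqr; field; nra].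
- rewrite atan_0, Rminus_0_r, !Rminus_0_r in E.
  rewrite E, Rabs_mult, <- (pow2_abs x).
  assert (Hcx : Rabs c <= Rabs x).
  { revert Hc; unfold Rmin, Rmax; destruct (Rle_dec 0 x); intros Hc.
    - rewrite !Rabs_pos_eq; lra.
    - rewrite !Rabs_left1; lra. }
  assert (Hd : Rabs (/ (1 + c²) - 1) <= Rabs c).
  { assert (H0 := Rle_0_sqr c).
    replace (/ (1 + c²) - 1) with (- (c² / (1 + c²))) by (field; lra).
    rewrite Rabs_Ropp, Rabs_pos_eq by (apply Rdiv_le_0_compat; lra).
    apply Rmult_le_reg_r with (1 + c²); [lra|].
    unfold Rdiv; rewrite Rmult_assoc, Rinv_l, Rmult_1_r by lra.
    rewrite (Rsqr_abs c); unfold Rsqr.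
    assert (H1 := Rabs_pos c). set (r := Rabs c) in *.
    assert (0 <= r * ((r - 1) ^ 2 + r)) by (apply Rmult_le_pos; nra). nra. }
  assert (H1 := Rabs_pos x). nra.
Qed.

(** The increment [b ln (1 + 1/n) - atan (b / (a + n + 1))] has the leading terms
    [b / n] and [- b / n], which cancel. *)
Lemma gamma_arg_cvg (a b : R) :
  0 < a -> exists l : R, is_lim_seq (gamma_arg a b) l.
Proof.
intros Ha; apply (ex_lim_telescoping _ (Rabs b * (1 + a) + b ^ 2)).
intros n Hn; unfold gamma_arg.
assert (Hp : 0 < INR n) by (apply lt_0_INR; lia).
assert (HL := ln_INR_S_bounds n Hn).
assert (HA := atan_sub_id_bound (b / (a + INR (S n)))).
set (s := psum _ (S n)); change (psum _ (S (S n)))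
  with (s + atan (b / (a + INR (S n)))).
set (x := INR n) in *; rewrite S_INR in *; fold x in HL, HA; fold x.
set (v := atan _) in *; clearbody v s x.
replace (b * ln (x + 1) - (s + v) - (b * ln x - s))
  with (b * (ln (x + 1) - ln x - / (a + (x + 1)))
        - (v - b / (a + (x + 1)))) by (field; lra).
set (d := ln (x + 1) - ln x) in *.
assert (Hd : Rabs (d - / (a + (x + 1))) <= (1 + a) * (/ x - / (x + 1))).
{ assert (/ (a + (x + 1)) <= / (x + 1)) by (apply Rinv_le_contravar; lra).
  rewrite Rabs_pos_eq by lra.
  apply Rle_trans with (/ x - / (a + (x + 1))); [lra|].
  replace (/ x - / (a + (x + 1))) with ((1 + a) * / (x * (x + 1 + a)))
    by (field; lra).
  replace (/ x - / (x + 1)) with (/ (x * (x + 1))) by (field; lra).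
  apply Rmult_le_compat_l; [lra|]; apply Rinv_le_contravar; nra. }
assert (Hq : (b / (a + (x + 1))) ^ 2 <= b ^ 2 * (/ x - / (x + 1))).
{ replace ((b / (a + (x + 1))) ^ 2) with (b ^ 2 * / (a + (x + 1)) ^ 2)
    by (field; lra).
  replace (/ x - / (x + 1)) with (/ (x * (x + 1))) by (field; lra).
  apply Rmult_le_compat_l; [nra|]; apply Rinv_le_contravar; nra. }
eapply Rle_trans; [apply Rabs_triang|].
rewrite Rabs_Ropp, Rabs_mult.
assert (Hb := Rabs_pos b); nra.
Qed.

(** The increment is [a ln (1 + 1/n) - ln q / 2], where
    [q = ((a + n + 1)^2 + b^2) / (n + 1)^2] and [ln q / 2] is [a / n] up to order
    [1 / n^2]. *)
Lemma gamma_log_cvg (a b : R) :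
  0 < a -> exists l : R, is_lim_seq (gamma_log a b) l.
Proof.
intros Ha; apply (ex_lim_telescoping _ (a * (1 + a) + a ^ 2 + b ^ 2)).
intros n Hn; unfold gamma_log.
assert (Hp : 0 < INR n) by (apply lt_0_INR; lia).
assert (HL := ln_INR_S_bounds n Hn).
rewrite fact_simpl, mult_INR, ln_mult
  by (try apply INR_fact_lt_0; apply lt_0_INR; lia).
set (s := psum _ (S n)); change (psum _ (S (S n)))
  with (s + ln ((a + INR (S n)) ^ 2 + b ^ 2) / 2).
set (lf := ln (INR (fact n))).
set (x := INR n) in *; rewrite S_INR in *; fold x in HL; fold x.
clearbody s lf x.
assert (Hq0 : 0 < ((a + (x + 1)) ^ 2 + b ^ 2) / (x + 1) ^ 2)
  by (apply Rdiv_lt_0_compat; nra).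
set (q := ((a + (x + 1)) ^ 2 + b ^ 2) / (x + 1) ^ 2) in *.
assert (Hsq : ln ((a + (x + 1)) ^ 2 + b ^ 2) = 2 * ln (x + 1) + ln q).
{ replace ((a + (x + 1)) ^ 2 + b ^ 2) with ((x + 1) * (x + 1) * q)
    by (unfold q; field; lra).
  rewrite !ln_mult by nra; ring. }
rewrite Hsq.
replace (_ - _) with (a * (ln (x + 1) - ln x) - ln q / 2) by field.
set (d := ln (x + 1) - ln x) in *.
assert (Hx1 : / (x + 1) ^ 2 <= / x - / (x + 1)).
{ replace (/ x - / (x + 1)) with (/ (x * (x + 1))) by (field; lra).
  apply Rinv_le_contravar; nra. }
assert (Hupq : ln q / 2 <= a * / (x + 1) + (a ^ 2 + b ^ 2) * / (x + 1) ^ 2).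
{ assert (H := ln_le_sub_1 q Hq0).
  assert (E : q - 1 = 2 * (a * / (x + 1)) + (a ^ 2 + b ^ 2) * / (x + 1) ^ 2)
    by (unfold q; field; lra).
  assert (0 <= (a ^ 2 + b ^ 2) * / (x + 1) ^ 2).
  { apply Rmult_le_pos; [nra|]; apply Rlt_le, Rinv_0_lt_compat; nra. }
  lra. }
(* Here [q] is at least its value at [b = 0], a square. *)
assert (Hloq : a * / (a + (x + 1)) <= ln q / 2).
{ assert (H : ln ((a + (x + 1)) / (x + 1) * ((a + (x + 1)) / (x + 1))) <= ln q).
  { apply ln_le.
    - assert (0 < (a + (x + 1)) / (x + 1)) by (apply Rdiv_lt_0_compat; lra).
      nra.
    - unfold q; apply Rmult_le_reg_r with ((x + 1) ^ 2); [nra|].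
      field_simplify; [nra|lra|lra]. }
  assert (H0 : 0 < (a + (x + 1)) / (x + 1)) by (apply Rdiv_lt_0_compat; lra).
  rewrite ln_mult in H by assumption.
  assert (H1 := ln_ge_1_sub_inv _ H0).
  replace (a * / (a + (x + 1))) with (1 - / ((a + (x + 1)) / (x + 1)))
    by (field; lra).
  lra. }
assert (Ha1 : a * / x - a * / (a + (x + 1))
              <= a * (1 + a) * (/ x - / (x + 1))).
{ replace (a * / x - a * / (a + (x + 1)))
    with (a * (1 + a) * / (x * (x + 1 + a))) by (field; lra).
  replace (/ x - / (x + 1)) with (/ (x * (x + 1))) by (field; lra).
  apply Rmult_le_compat_l; [nra|]; apply Rinv_le_contravar; nra. }
assert (Hxx : 0 <= / x - / (x + 1)).
{ assert (/ (x + 1) <= / x) by (apply Rinv_le_contravar; lra); lra. }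
apply Rabs_le; split.
- assert ((a ^ 2 + b ^ 2) * / (x + 1) ^ 2 <= (a ^ 2 + b ^ 2) * (/ x - / (x + 1)))
    by (apply Rmult_le_compat_l; nra).
  assert (0 <= a * (1 + a) * (/ x - / (x + 1)))
    by (apply Rmult_le_pos; nra).
  assert (a * / (x + 1) <= a * d) by (apply Rmult_le_compat_l; lra).
  lra.
- assert (0 <= (a ^ 2 + b ^ 2) * (/ x - / (x + 1))) by (apply Rmult_le_pos; nra).
  assert (a * d <= a * / x) by (apply Rmult_le_compat_l; lra).
  lra.
Qed.

(** Convergence of the logarithm of the modulus, and not only of the modulus,
    makes the limit nonzero, so that its argument is meaningful. *)
Lemma Gamma_polar (a b : R) :
  0 < a ->
  exists lambda alpha : R,
    is_lim_seq (gamma_arg a b) alpha /\ Gamma (a, b) = polar (exp lambda) alpha.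
Proof.
intros Ha.
destruct (gamma_log_cvg a b Ha) as [lambda Hl].
destruct (gamma_arg_cvg a b Ha) as [alpha Hal].
exists lambda, alpha; split; [assumption|].
assert (He : is_lim_seq (fun n => exp (gamma_log a b n)) (exp lambda)).
{ apply is_lim_seq_continuous; [|assumption].
  apply derivable_continuous_pt, derivable_pt_exp. }
unfold Gamma, polar; f_equal.
- rewrite (is_lim_seq_unique _ (exp lambda * cos alpha)); [reflexivity|].
  apply is_lim_seq_ext with
    (fun n => exp (gamma_log a b n) * cos (gamma_arg a b n)).
  + intros n; rewrite gamma_seq_polar by assumption; reflexivity.
  + apply is_lim_seq_mult'; [assumption|].
    apply is_lim_seq_continuous; [apply continuity_cos|assumption].
- rewrite (is_lim_seq_unique _ (exp lambda * sin alpha)); [reflexivity|].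
  apply is_lim_seq_ext with
    (fun n => exp (gamma_log a b n) * sin (gamma_arg a b n)).
  + intros n; rewrite gamma_seq_polar by assumption; reflexivity.
  + apply is_lim_seq_mult'; [assumption|].
    apply is_lim_seq_continuous; [apply continuity_sin|assumption].
Qed.

(** * The arctangent series of the reflection formula *)

Lemma atan_sub_nonneg (x y : R) :
  0 <= x -> 0 <= y -> atan x - atan y = atan ((x - y) / (1 + x * y)).
Proof.
intros Hx Hy.
assert (Hpos : forall z, 0 <= z -> 0 <= atan z).
{ intros z [Hz| <-]; [|rewrite atan_0; lra].
  apply Rlt_le; rewrite <- atan_0; apply atan_increasing; assumption. }
assert (Hax := atan_bound x); assert (Hay := atan_bound y).
assert (Hx0 := Hpos x Hx); assert (Hy0 := Hpos y Hy).
rewrite (atan_sub_correct x y); [unfold atan_sub; ring|nra|lra|].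
apply atan_bound.
Qed.

(** For [0 < a < pi] this is the argument of sin (a + i y), because
    sin (a + i y) = sin a cosh y + i cos a sinh y gives
    tan (arg (sin (a + i y))) = tanh y * cot a. *)
Definition tanh_cot (a y : R) : R := atan (tanh y * cos a / sin a).

Lemma tanh_bounds (y : R) : 0 <= y -> 0 <= tanh y < 1.
Proof.
intros Hy; unfold tanh, sinh, cosh.
assert (H1 := exp_pos y); assert (H2 := exp_pos (- y)).
assert (H3 : exp (- y) <= exp y) 
  by (apply Rnot_lt_le; intros H; apply exp_lt_inv in H; lra).
split.
- apply Rdiv_le_0_compat; lra.
- apply Rmult_lt_reg_r with ((exp y + exp (- y)) / 2); [lra|].
  unfold Rdiv at 1; rewrite Rmult_assoc, Rinv_l; lra.
Qed.

Lemma tanh_double (y : R) :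
  tanh (2 * y) = 2 * tanh y / (1 + tanh y ^ 2).
Proof.
unfold tanh, sinh, cosh.
replace (2 * y) with (y + y) by ring.
rewrite !Ropp_plus_distr, !exp_plus, !exp_Ropp.
assert (H := exp_pos y); set (e := exp y) in *.
field; repeat split; nra.
Qed.

(** The argument of sin (2w) = 2 sin w cos w = 2 sin w sin (w + pi/2) at
    w = a + i y; the minus sign comes from cot (a + pi/2) = - cot (pi/2 - a). *)
Lemma tanh_cot_halve (a y : R) :
  0 < a < PI / 2 -> 0 <= y ->
  tanh_cot (2 * a) (2 * y) = tanh_cot a y - tanh_cot (PI / 2 - a) y.
Proof.
intros Ha Hy; unfold tanh_cot.
rewrite cos_shift, sin_shift, cos_2a, sin_2a, tanh_double.
assert (Hs : 0 < sin a) by (apply sin_gt_0; lra).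
assert (Hc : 0 < cos a) by (apply cos_gt_0; lra).
destruct (tanh_bounds y Hy) as [Ht0 Ht1].
rewrite atan_sub_nonneg.
- f_equal; field; repeat split; nra.
- apply Rdiv_le_0_compat; nra.
- apply Rdiv_le_0_compat; nra.
Qed.

(** With [e = mesh m], the pair [(2 * e, 2 * (2 * t * e))] is
    [(pi/4, pi t / 2)] at [m = 0], the point to which the halving is first
    applied. *)
Definition mesh (m : nat) : R := PI / (8 * 2 ^ m).

Lemma mesh_S (m : nat) : mesh m = 2 * mesh (S m).
Proof.
unfold mesh; assert (0 < 2 ^ m) by (apply pow_lt; lra).
simpl pow; field; lra.
Qed.

Lemma mesh_quarter (m : nat) : PI / 2 = 4 * INR (2 ^ m) * mesh m.
Proof.
unfold mesh; rewrite pow_INR; change (INR 2) with (1 + 1).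
assert (0 < 2 ^ m) by (apply pow_lt; lra).
replace (1 + 1) with 2 by ring; field; lra.
Qed.

Lemma mesh_pos (m : nat) : 0 < mesh m.
Proof.
assert (0 < 2 ^ m) by (apply pow_lt; lra); assert (Hpi := PI_RGT_0).
apply Rdiv_lt_0_compat; lra.
Qed.

(** Halving every term of the sum for [m] yields a term with the same [l] and a
    term at the complementary angle, which is the one of index
    [2^(m+1) - 1 - l] in the sum for [m + 1]. *)
Lemma tanh_cot_quarter_sum (t : R) (m : nat) :
  0 <= t ->
  atan (tanh (PI * t / 2)) =
  psum (fun l => tanh_cot ((4 * INR l + 1) * mesh m) (2 * t * mesh m)
               - tanh_cot ((4 * INR l + 3) * mesh m) (2 * t * mesh m)) (2 ^ m).
Proof.
intros Ht; assert (Hpi := PI_RGT_0); induction m as [|m IH].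
- replace (atan _) with (tanh_cot (2 * mesh 0) (2 * (2 * t * mesh 0))).
  + rewrite tanh_cot_halve.
    * simpl; unfold mesh; simpl; rewrite Rplus_0_l; f_equal; f_equal; field.
    * unfold mesh; simpl; lra.
    * generalize (mesh_pos 0); nra.
  + unfold tanh_cot; f_equal.
    replace (2 * (2 * t * mesh 0)) with (PI * t / 2) by (unfold mesh; simpl; field).
    replace (2 * mesh 0) with (PI / 4) by (unfold mesh; simpl; field).
    rewrite cos_PI4, sin_PI4; field; apply Rgt_not_eq, sqrt_lt_R0; lra.
- rewrite IH; clear IH.
  assert (He := mesh_pos (S m)); assert (Hq := mesh_quarter (S m)).
  rewrite mesh_S; set (e := mesh (S m)) in *.
  set (f := fun l : nat => _ - _ : R) at 2.
  transitivity (psum (fun l => f l + f (2 ^ m + (2 ^ m - 1 - l))%nat) (2 ^ m)).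
  + apply psum_ext; intros l Hl.
    assert (Hl' : INR l + 1 <= INR (2 ^ m))
      by (rewrite <- S_INR; apply le_INR; lia).
    assert (H0 := pos_INR l).
    unfold f; rewrite plus_INR, !minus_INR by lia.
    change (INR 1) with 1.
    simpl (2 ^ S m)%nat in Hq; rewrite !plus_INR in Hq; simpl (INR 0) in Hq.
    replace (2 * t * (2 * e)) with (2 * (2 * t * e)) by ring.
    replace ((4 * INR l + 1) * (2 * e)) with (2 * ((4 * INR l + 1) * e)) by ring.
    replace ((4 * INR l + 3) * (2 * e)) with (2 * ((4 * INR l + 3) * e)) by ring.
    rewrite !tanh_cot_halve by nra.
    set (M := INR (2 ^ m)) in *.
    replace (PI / 2 - (4 * INR l + 1) * e)
      with ((4 * (M + (M - 1 - INR l)) + 3) * e) by (rewrite Hq; ring).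
    replace (PI / 2 - (4 * INR l + 3) * e)
      with ((4 * (M + (M - 1 - INR l)) + 1) * e) by (rewrite Hq; ring).
    ring.
  + rewrite psum_plus.
    rewrite <- (psum_rev (fun k => f (2 ^ m + k)%nat)).
    rewrite <- psum_add; f_equal; simpl; lia.
Qed.

Lemma tanh_cot_decr (a b y : R) :
  0 < a -> a <= b -> b <= PI / 2 -> 0 <= y -> tanh_cot b y <= tanh_cot a y.
Proof.
intros Ha Hab Hb Hy; unfold tanh_cot.
assert (Hsa : 0 < sin a) by (apply sin_gt_0; lra).
assert (Hsb : 0 < sin b) by (apply sin_gt_0; lra).
assert (Hcb : 0 <= cos b) by (apply cos_ge_0; lra).
assert (Hc : cos b <= cos a) by (apply cos_decr_1; lra).
assert (Hs : sin a <= sin b) by (apply sin_incr_1; lra).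
destruct (tanh_bounds y Hy) as [Ht0 _].
assert (H : tanh y * cos b / sin b <= tanh y * cos a / sin a).
{ apply Rmult_le_compat; [nra| |nra|].
  - apply Rlt_le, Rinv_0_lt_compat; assumption.
  - apply Rinv_le_contravar; assumption. }
destruct H as [H| ->]; [apply Rlt_le, atan_increasing; assumption|lra].
Qed.

Lemma tanh_cot_nonneg (a y : R) :
  0 < a -> a <= PI / 2 -> 0 <= y -> 0 <= tanh_cot a y.
Proof.
intros Ha Hb Hy.
replace 0 with (tanh_cot (PI / 2) y); [apply tanh_cot_decr; lra|].
unfold tanh_cot; rewrite cos_PI2, Rmult_0_r; unfold Rdiv; rewrite Rmult_0_l.
apply atan_0.
Qed.

(** For the alternating sum of a decreasing function, what follows a given pair is
    nonnegative and at most the first omitted term. *)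
Lemma psum_pairs_bound (f : R -> R) (L n : nat) :
  (forall l, (l < L + S n)%nat -> f (4 * INR l + 3) <= f (4 * INR l + 1)) ->
  (forall l, (l < L + n)%nat -> f (4 * INR l + 5) <= f (4 * INR l + 3)) ->
  0 <= f (4 * INR (L + n) + 3) ->
  0 <= psum (fun l => f (4 * INR l + 1) - f (4 * INR l + 3)) (L + S n)
       - psum (fun l => f (4 * INR l + 1) - f (4 * INR l + 3)) L
    <= f (4 * INR L + 1).
Proof.
intros H1 H2 H3; rewrite psum_add.
set (g := fun k : nat => f (4 * INR (L + k) + 1) - f (4 * INR (L + k) + 3)).
enough (H : 0 <= psum g (S n) <= f (4 * INR L + 1) - f (4 * INR (L + n) + 3))
  by lra.
clear H3; induction n as [|n IH].
- cbn [psum]; unfold g; rewrite Nat.add_0_r.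
  specialize (H1 L ltac:(lia)); lra.
- change (psum g (S (S n))) with (psum g (S n) + g (S n)).
  assert (H := IH ltac:(intros; apply H1; lia) ltac:(intros; apply H2; lia)).
  unfold g at 2 4.
  assert (H1' := H1 (L + S n)%nat ltac:(lia)).
  assert (H2' := H2 (L + n)%nat ltac:(lia)).
  replace (L + S n)%nat with (S (L + n)) in * by lia.
  rewrite S_INR in *.
  replace (4 * (INR (L + n) + 1) + 1) with (4 * INR (L + n) + 5) in * by ring.
  lra.
Qed.

Lemma is_lim_seq_quotient_mesh (f : R -> R) (l : R) :
  is_derive f 0 l -> f 0 = 0 -> is_lim_seq (fun m => f (mesh m) / mesh m) l.
Proof.
intros Hf Hf0; apply is_lim_seq_spec; intros eps.
apply is_derive_Reals in Hf.
destruct (Hf eps (cond_pos eps)) as [d Hd].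
assert (Hm : is_lim_seq mesh 0).
{ apply is_lim_seq_ext with (fun m => PI / 8 * (/ 2) ^ m).
  - intros m; unfold mesh; rewrite pow_inv.
    assert (0 < 2 ^ m) by (apply pow_lt; lra); field; lra.
  - replace (Finite 0) with (Rbar_mult (PI / 8) 0) by (simpl; f_equal; ring).
    apply is_lim_seq_scal_l, is_lim_seq_geom.
    rewrite Rabs_pos_eq; lra. }
apply is_lim_seq_spec in Hm; destruct (Hm d) as [N HN].
exists N; intros m Hmn; specialize (HN m Hmn).
assert (H := mesh_pos m); rewrite Rminus_0_r in HN.
specialize (Hd (mesh m) ltac:(lra) HN).
rewrite Rplus_0_l, Hf0, Rminus_0_r in Hd; exact Hd.
Qed.

Lemma tanh_cot_mesh_lim (t q : R) :
  q <> 0 ->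
  is_lim_seq (fun m => tanh_cot (q * mesh m) (2 * t * mesh m))
             (atan (2 * t / q)).
Proof.
intros Hq; unfold tanh_cot.
apply (is_lim_seq_continuous atan);
  [apply derivable_continuous_pt, derivable_pt_atan|].
apply is_lim_seq_ext with
  (fun m => (tanh (2 * t * mesh m) * cos (q * mesh m) / mesh m)
            / (sin (q * mesh m) / mesh m)).
- intros m; assert (H := mesh_pos m).
  unfold Rdiv; rewrite Rinv_mult, Rinv_inv.
  generalize (/ sin (q * mesh m)); intros i; field; lra.
- apply (is_lim_seq_div' _ _ (2 * t) q); [| |assumption].
  + apply (is_lim_seq_quotient_mesh
             (fun x => tanh (2 * t * x) * cos (q * x))).
    * unfold tanh, sinh, cosh; auto_derive.
      -- rewrite Rmult_0_r, Ropp_0, exp_0; lra.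
      -- rewrite !Rmult_0_r, Ropp_0, exp_0, cos_0, sin_0; field.
    * unfold tanh, sinh, cosh; rewrite Rmult_0_r, Ropp_0, exp_0; field.
  + apply (is_lim_seq_quotient_mesh (fun x => sin (q * x))).
    * auto_derive; [exact I|rewrite Rmult_0_r, cos_0; ring].
    * rewrite Rmult_0_r; apply sin_0.
Qed.

Definition atan_pair (t : R) (k : nat) : R :=
  atan (2 * t / (4 * INR k + 1)) - atan (2 * t / (4 * INR k + 3)).

(** The alternating-sum bound holds for each mesh with a right-hand side that
    converges, so it survives the passage to the limit term by term. *)
Lemma atan_pairs_bound (t : R) (L : nat) :
  0 <= t ->
  0 <= atan (tanh (PI * t / 2)) - psum (atan_pair t) L
    <= atan (2 * t / (4 * INR L + 1)).
Proof.
intros Ht.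
pose (f := fun m x => tanh_cot (x * mesh m) (2 * t * mesh m)).
(* The shift of [m] by [L + 1] ensures that the sum has more than [L] pairs. *)
pose (s := fun m => psum (fun l => f m (4 * INR l + 1) - f m (4 * INR l + 3)) L).
assert (HL := pos_INR L).
assert (Hb : forall m, 0 <= atan (tanh (PI * t / 2)) - s (L + 1 + m)%nat
                         <= f (L + 1 + m)%nat (4 * INR L + 1)).
{ intros m0; set (m := (L + 1 + m0)%nat).
  assert (HLm : (L < 2 ^ m)%nat).
  { apply Nat.lt_le_trans with m; [lia|].
    apply Nat.lt_le_incl, Nat.pow_gt_lin_r; lia. }
  unfold s; rewrite (tanh_cot_quarter_sum t m Ht).
  assert (Hm := mesh_pos m); assert (Hq := mesh_quarter m).
  destruct (Nat.le_exists_sub (S L) (2 ^ m) HLm) as [n [Hn _]].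
  assert (HM : INR (2 ^ m) = INR L + INR n + 1)
    by (rewrite Hn, plus_INR, S_INR; ring).
  rewrite Hn; replace (n + S L)%nat with (L + S n)%nat by lia.
  apply (psum_pairs_bound (f m) L n); unfold f.
  1,2: intros l Hl; assert (Hl0 := pos_INR l);
    apply tanh_cot_decr; [nra|nra| |nra];
    rewrite Hq, HM; apply Rmult_le_compat_r; [lra|].
  - assert (INR l <= INR (L + n)) by (apply le_INR; lia).
    rewrite plus_INR in *; lra.
  - assert (INR (S l) <= INR (L + n)) by (apply le_INR; lia).
    rewrite plus_INR, S_INR in *; lra.
  - assert (Hn0 := pos_INR n); rewrite plus_INR.
    apply tanh_cot_nonneg; [nra| |nra].
    rewrite Hq, HM; apply Rmult_le_compat_r; lra. }
assert (Hs : is_lim_seq (fun m => s (L + 1 + m)%nat) (psum (atan_pair t) L)).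
{ apply is_lim_seq_ext with (fun m => s (m + (L + 1))%nat);
    [intros; f_equal; lia|].
  apply (is_lim_seq_incr_n s), psum_lim; intros k _.
  assert (Hk := pos_INR k).
  apply is_lim_seq_minus'; apply tanh_cot_mesh_lim; lra. }
split.
- apply (is_lim_seq_le (fun _ => 0)
    (fun m => atan (tanh (PI * t / 2)) - s (L + 1 + m)%nat) 0
    (atan (tanh (PI * t / 2)) - psum (atan_pair t) L)).
  + intros m; apply Hb.
  + apply is_lim_seq_const.
  + apply is_lim_seq_minus'; [apply is_lim_seq_const|exact Hs].
- apply (is_lim_seq_le
    (fun m => atan (tanh (PI * t / 2)) - s (L + 1 + m)%nat)
    (fun m => f (L + 1 + m)%nat (4 * INR L + 1))
    (atan (tanh (PI * t / 2)) - psum (atan_pair t) L)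
    (atan (2 * t / (4 * INR L + 1)))).
  + intros m; apply Hb.
  + apply is_lim_seq_minus'; [apply is_lim_seq_const|exact Hs].
  + apply is_lim_seq_ext with (fun m => f (m + (L + 1))%nat (4 * INR L + 1));
      [intros; f_equal; lia|].
    apply (is_lim_seq_incr_n (fun m => f m (4 * INR L + 1))).
    apply tanh_cot_mesh_lim; lra.
Qed.

Lemma atan_pairs_lim (t : R) :
  0 <= t -> is_lim_seq (psum (atan_pair t)) (atan (tanh (PI * t / 2))).
Proof.
intros Ht; set (G := atan (tanh (PI * t / 2))).
apply is_lim_seq_le_le with
  (fun L => G - atan (2 * t / (4 * INR L + 1))) (fun _ => G).
- intros L; assert (H := atan_pairs_bound t L Ht); fold G in H; lra.
- replace (Finite G) with (Finite (G - atan 0)) by (rewrite atan_0; f_equal; ring).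
  apply is_lim_seq_minus'; [apply is_lim_seq_const|].
  apply (is_lim_seq_continuous atan);
    [apply derivable_continuous_pt, derivable_pt_atan|].
  replace (Finite 0) with (Rbar_div (2 * t) p_infty)
    by (simpl; f_equal; ring).
  apply is_lim_seq_div with (2 * t) p_infty.
  + apply is_lim_seq_const.
  + apply is_lim_seq_le_p_loc with INR; [|apply is_lim_seq_INR].
    exists 0%nat; intros n _; generalize (pos_INR n); lra.
  + discriminate.
  + reflexivity.
- apply is_lim_seq_const.
Qed.

(** tanh (x/2) = (1 - e^(-x)) / (1 + e^(-x)) is the tangent of a difference. *)
Lemma atan_tanh_half (x : R) :
  0 <= x -> atan (tanh (x / 2)) = PI / 4 - atan (exp (- x)).
Proof.
intros Hx; rewrite <- atan_1, atan_sub_nonneg; [|lra|apply Rlt_le, exp_pos].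
f_equal; unfold tanh, sinh, cosh.
replace (- x) with (- (x / 2) + - (x / 2)) by field.
rewrite exp_plus, exp_Ropp.
assert (H := exp_pos (x / 2)); field; split; nra.
Qed.

(** * Duplication and reflection for arguments *)

(** Reflection: since 3/4 - i t/2 = 1 - (1/4 + i t/2), the difference of the two
    arguments is the argument of Gamma(z) Gamma(1 - z). *)
Lemma gamma_arg_quarter_three_quarters_diff (t : R) (n : nat) :
  gamma_arg (1 / 4) (t / 2) n - gamma_arg (3 / 4) (t / 2) n
  = - psum (atan_pair t) (S n).
Proof.
unfold gamma_arg, atan_pair; rewrite psum_minus.
rewrite (psum_ext (fun k => atan (t / 2 / (1 / 4 + INR k)))
                  (fun k => atan (2 * t / (4 * INR k + 1)))).
rewrite (psum_ext (fun k => atan (t / 2 / (3 / 4 + INR k)))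
                  (fun k => atan (2 * t / (4 * INR k + 3)))).
- ring.
- intros k _; assert (H := pos_INR k); f_equal; field; lra.
- intros k _; assert (H := pos_INR k); f_equal; field; lra.
Qed.

(** Duplication: the factors 1/4 + k + i t/2 and 3/4 + k + i t/2 are halves of
    consecutive factors 1/2 + j + i t, with j = 2k and j = 2k + 1. *)
Lemma gamma_arg_quarter_three_quarters_sum (t : R) (n : nat) :
  gamma_arg (1 / 4) (t / 2) n + gamma_arg (3 / 4) (t / 2) n
  = gamma_arg (1 / 2) t (2 * n + 1) + t * (ln (INR n) - ln (INR (2 * n + 1))).
Proof.
unfold gamma_arg.
replace (S (2 * n + 1)) with (2 * S n)%nat by lia.
rewrite <- psum_double, psum_plus.
rewrite (psum_ext (fun k => atan (t / 2 / (1 / 4 + INR k)))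
                  (fun k => atan (t / (1 / 2 + INR (2 * k))))).
rewrite (psum_ext (fun k => atan (t / 2 / (3 / 4 + INR k)))
                  (fun k => atan (t / (1 / 2 + INR (2 * k + 1))))).
- field.
- intros k _; assert (H := pos_INR k); rewrite plus_INR, mult_INR; simpl.
  f_equal; field; lra.
- intros k _; assert (H := pos_INR k); rewrite mult_INR; simpl.
  f_equal; field; lra.
Qed.

Lemma ln_ratio_lim :
  is_lim_seq (fun n => ln (INR n) - ln (INR (2 * n + 1))) (- ln 2).
Proof.
apply (is_lim_seq_incr_1 (fun n => ln (INR n) - ln (INR (2 * n + 1)))).
apply is_lim_seq_ext with (fun n => - ln (2 + / INR (S n))).
- intros n; assert (H : 0 < INR (S n)) by (apply lt_0_INR; lia).
  assert (Hi := Rinv_0_lt_compat _ H).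
  replace (INR (2 * S n + 1)) with (INR (S n) * (2 + / INR (S n))).
  + rewrite ln_mult by lra; ring.
  + rewrite plus_INR, mult_INR; change (INR 1) with 1; change (INR 2) with 2.
    field; lra.
- apply (is_lim_seq_opp _ (ln 2)).
  apply (is_lim_seq_continuous ln);
    [apply derivable_continuous_pt; exists (/ 2); apply derivable_pt_lim_ln; lra|].
  replace (Finite 2) with (Finite (2 + 0)) by (f_equal; ring).
  apply is_lim_seq_plus'; [apply is_lim_seq_const|].
  apply (is_lim_seq_incr_1 (fun n => / INR n)).
  replace (Finite 0) with (Rbar_inv p_infty) by reflexivity.
  apply is_lim_seq_inv; [apply is_lim_seq_INR|discriminate].
Qed.

Lemma gamma_arg_duplication (t alpha beta : R) :
  0 <= t ->
  is_lim_seq (gamma_arg (1 / 4) (t / 2)) alpha ->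
  is_lim_seq (gamma_arg (1 / 2) t) beta ->
  2 * alpha = beta - t * ln 2 - PI / 4 + atan (exp (- PI * t)).
Proof.
intros Ht Ha Hb.
assert (H : is_lim_seq (fun n => 2 * gamma_arg (1 / 4) (t / 2) n)
              (beta + t * - ln 2 - atan (tanh (PI * t / 2)))).
{ apply is_lim_seq_ext with (fun n =>
    gamma_arg (1 / 2) t (2 * n + 1) + t * (ln (INR n) - ln (INR (2 * n + 1)))
    - psum (atan_pair t) (S n)).
  - intros n; rewrite <- gamma_arg_quarter_three_quarters_sum.
    assert (Hd := gamma_arg_quarter_three_quarters_diff t n); lra.
  - apply is_lim_seq_minus'; [apply is_lim_seq_plus'|].
    + apply (is_lim_seq_subseq (gamma_arg (1 / 2) t) beta
               (fun n => (2 * n + 1)%nat)); [|assumption].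
      apply eventually_subseq; intros n; lia.
    + apply (is_lim_seq_scal_l _ t (- ln 2)), ln_ratio_lim.
    + apply (is_lim_seq_incr_1 (psum (atan_pair t))), atan_pairs_lim; assumption. }
apply is_lim_seq_unique in H.
assert (H2 := is_lim_seq_scal_l _ 2 alpha Ha).
apply is_lim_seq_unique in H2; rewrite H in H2; simpl in H2.
injection H2 as H2.
rewrite atan_tanh_half in H2 by (generalize PI_RGT_0; nra).
replace (- PI * t) with (- (PI * t)) by ring; lra.
Qed.

(** * Theta as an argument of Gamma(1/2 + i t) *)

Lemma same_direction (r s phi psi : R) :
  0 < r -> 0 < s -> polar r phi = polar s psi ->
  cos phi = cos psi /\ sin phi = sin psi.
Proof.
intros Hr Hs H.
assert (E : r = s).
{ rewrite <- (Cmod_polar r phi), H, Cmod_polar; lra. }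
subst s; injection H as H1 H2.
split; apply Rmult_eq_reg_l with r; lra.
Qed.

(** Otherwise the intermediate value theorem produces a nonzero value strictly
    between [-pi] and [pi], where the cosine is not 1. *)
Lemma continuous_cos_1_eq_0 (D : R -> R) :
  continuity D -> D 0 = 0 -> (forall t, 0 <= t -> cos (D t) = 1) ->
  forall t, 0 <= t -> D t = 0.
Proof.
intros HD HD0 Hcos t Ht.
assert (Hpi := PI_RGT_0).
destruct (Req_dec (D t) 0) as [|Hne]; [assumption|exfalso].
assert (Hv : exists v, Rmin (D 0) (D t) <= v <= Rmax (D 0) (D t)
                       /\ v <> 0 /\ - PI < v < PI).
{ rewrite HD0; destruct (Rtotal_order (D t) 0) as [H|[H|H]]; [|lra|].
  (* Truncation at half of [pi] keeps the value inside the period. *)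
  - exists (Rmax (D t) (- PI / 2)).
    rewrite Rmin_right, (Rmax_left 0) by lra.
    unfold Rmax; destruct (Rle_dec _ _); lra.
  - exists (Rmin (D t) (PI / 2)).
    rewrite Rmin_left, Rmax_right by lra.
    unfold Rmin; destruct (Rle_dec _ _); lra. }
destruct Hv as [v [Hv [Hv0 Hvpi]]].
destruct (IVT_gen D 0 t v HD Hv) as [s [Hs Es]].
(* The cosine is known to be 1 only on the nonnegative axis, which contains [s]. *)
rewrite Rmin_left in Hs by assumption.
specialize (Hcos s (proj1 Hs)); rewrite Es in Hcos.
destruct (Rtotal_order v 0) as [H|[H|H]]; [|lra|].
- assert (cos 0 > cos (- v)) by (apply cos_decreasing_1; lra).
  rewrite cos_neg, cos_0 in *; lra.
- assert (cos 0 > cos v) by (apply cos_decreasing_1; lra).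
  rewrite cos_0 in *; lra.
Qed.

Lemma is_argument_polar (w : C) (phi : R) :
  is_argument w phi -> w = polar (Cmod w) phi.
Proof.
intros H; unfold is_argument in H; rewrite H at 1; clear H.
generalize (Cmod w) as r; intros r; unfold Cexp, polar; simpl.
replace (0 * phi - 1 * 0) with 0 by ring.
replace (0 * 0 + 1 * phi) with phi by ring.
rewrite exp_0; apply injective_projections; simpl; ring.
Qed.

Lemma Cexp_polar (w : C) : Cexp w = polar (exp (Re w)) (Im w).
Proof. reflexivity. Qed.

(** Complex differentiability uses the modulus for neighbourhoods in the domain
    and pairs of intervals in the codomain; restricting to a vertical line and
    projecting to the imaginary part bridges the two. *)
Lemma lnGamma_vertical_continuous (L : C -> C) (a : R) :
  is_lnGamma L -> 0 < a -> continuity (fun t => Im (L (a, t))).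
Proof.
intros HL Ha t.
assert (Hex : @ex_derive C_AbsRing C_NormedModule L (a, t))
  by (apply (lnGamma_holomorphic L HL); left; exact Ha).
apply ex_derive_continuous in Hex.
apply continuity_pt_filterlim.
intros P HP.
assert (H := Hex (fun z => P (snd z))); unfold filtermap in H.
assert (Hl : locally (L (a, t)) (fun z : C => P (snd z))).
{ destruct HP as [e He]; exists e; intros z [_ Hz]; apply He; exact Hz. }
destruct (H Hl) as [e He].
exists e; intros s Hs; apply (He (a, s)).
change (Cmod ((a, s) - (a, t))%C < e).
replace ((a, s) - (a, t))%C with (0, s - t)
  by (apply injective_projections; simpl; ring).
unfold Cmod; simpl fst; simpl snd.
replace (0 ^ 2 + (s - t) ^ 2) with ((s - t)²) by (unfold Rsqr; ring).
rewrite sqrt_Rsqr_abs; exact Hs.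
Qed.

(** [theta t + (t/2) ln pi] and [Im (L (1/2 + i t))] agree modulo [2 pi] with the
    limits of [gamma_arg] at 1/4 + i t/2 and 1/2 + i t, which
    [gamma_arg_duplication] relates; continuity removes the ambiguity. *)
Lemma theta_lnGamma (L : C -> C) (theta : R -> R) :
  is_lnGamma L -> is_RS_theta theta ->
  forall t, 0 <= t ->
  theta t = Im (L (1 / 2, t)) / 2 - t / 2 * ln (2 * PI) - PI / 8
            + atan (exp (- PI * t)) / 2.
Proof.
intros HL Hth t Ht; assert (Hpi := PI_RGT_0).
pose (D := fun s => 2 * (theta s + s / 2 * ln PI)
  - (Im (L (1 / 2, s)) - s * ln 2 - PI / 4 + atan (exp (- PI * s)))).
enough (HD : D t = 0) by (unfold D in HD; rewrite ln_mult by lra; lra).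
revert t Ht; apply continuous_cos_1_eq_0.
- intros s; unfold D.
  apply (continuity_pt_minus (fun s => 2 * (theta s + s / 2 * ln PI))).
  + apply (continuity_pt_scal (fun s => theta s + s / 2 * ln PI)).
    apply (continuity_pt_plus theta).
    * apply continuity_pt_filterlim, Hth.
    * apply ex_derive_continuity_pt; auto_derive; exact I.
  + apply (continuity_pt_plus (fun s => Im (L (1 / 2, s)) - s * ln 2 - PI / 4)).
    * apply (continuity_pt_minus (fun s => Im (L (1 / 2, s)) - s * ln 2)).
      -- apply (continuity_pt_minus (fun s => Im (L (1 / 2, s)))).
         ++ apply (lnGamma_vertical_continuous L (1 / 2) HL); lra.
         ++ apply ex_derive_continuity_pt;
              auto_derive; exact I.
      -- apply continuity_pt_const; intros x y; reflexivity.
    * apply ex_derive_continuity_pt; auto_derive; exact I.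
- unfold D; rewrite (theta_0 _ Hth).
  destruct (lnGamma_real L HL (1 / 2) ltac:(lra)) as [HI _].
  unfold RtoC in HI; rewrite HI, !Rmult_0_r, exp_0, atan_1; field.
- intros t Ht; unfold D.
  destruct (Gamma_polar (1 / 4) (t / 2)) as [la [al [Hal Ga]]]; [lra|].
  destruct (Gamma_polar (1 / 2) t) as [lb [be [Hbe Gb]]]; [lra|].
  assert (Hdup := gamma_arg_duplication t al be Ht Hal Hbe).
  assert (Hphi := is_argument_polar _ _ (theta_argument _ Hth t)).
  replace (Ci * RtoC t / RtoC 2 + RtoC (1 / 4))%C with (1 / 4, t / 2) in Hphi
    by (apply injective_projections; simpl; field).
  rewrite Ga, Cmod_polar in Hphi by apply Rlt_le, exp_pos.
  apply same_direction in Hphi; try apply exp_pos.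
  assert (Hpsi := lnGamma_exp L HL (1 / 2, t) ltac:(left; simpl; lra)).
  rewrite Cexp_polar, Gb in Hpsi.
  apply same_direction in Hpsi; try apply exp_pos.
  set (phi := theta t + t / 2 * ln PI) in *.
  set (psi := Im (L (1 / 2, t))) in *.
  (* Both angles [phi - al] and [psi - be] are multiples of [2 pi]. *)
  replace (2 * phi - _) with (2 * (phi - al) - (psi - be)) by lra.
  destruct Hphi as [Hc1 Hs1], Hpsi as [Hc2 Hs2].
  assert (E1 : cos (phi - al) = 1 /\ sin (phi - al) = 0).
  { rewrite cos_minus, sin_minus, Hc1, Hs1.
    assert (H := sin2_cos2 phi); unfold Rsqr in H; split; nra. }
  assert (E2 : cos (psi - be) = 1).
  { rewrite cos_minus, Hc2, Hs2.
    assert (H := sin2_cos2 be); unfold Rsqr in H; nra. }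
  rewrite cos_minus, cos_2a, sin_2a, (proj1 E1), (proj2 E1), E2; ring.
Qed.

(** * Stirling terms on the imaginary axis *)

Lemma Ci_pow_even (j : nat) : (Ci ^ (2 * j))%C = RtoC ((-1) ^ j).
Proof.
induction j as [|j IH]; [reflexivity|].
replace (2 * S j)%nat with (S (S (2 * j))) by lia.
cbn [Cpow]; rewrite IH; simpl pow.
apply injective_projections; simpl; ring.
Qed.

Lemma Ttilde_eq (j : nat) (t : R) :
  0 < t -> (1 <= j)%nat ->
  Ttilde j t = Rabs (bernoulli (2 * j) (1 / 2))
               / (4 * INR j * (2 * INR j - 1) * t ^ (2 * j - 1)).
Proof.
intros Ht Hj; unfold Ttilde, That.
assert (Hj1 : 1 <= INR j) by (change 1 with (INR 1); apply le_INR; lia).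
assert (Hp : 0 < t ^ (2 * j - 1)) by (apply pow_lt; assumption).
replace (INR (2 * j - 1)) with (2 * INR j - 1)
  by (rewrite minus_INR, mult_INR by lia; simpl; ring).
replace (INR (2 * j)) with (2 * INR j) by (rewrite mult_INR; reflexivity).
assert (Hd : 0 < 2 * INR j * (2 * INR j - 1) * t ^ (2 * j - 1))
  by (repeat apply Rmult_lt_0_compat; lra).
rewrite <- RtoC_pow, <- !RtoC_mult, <- RtoC_div, Cmod_R by lra.
rewrite Rabs_div, (Rabs_pos_eq (_ * _)) by lra.
field; repeat split; lra.
Qed.

Lemma Im_That_imaginary (j : nat) (t : R) :
  0 < t -> (1 <= j)%nat -> Im (That j (Ci * RtoC t)) = 2 * Ttilde j t.
Proof.
intros Ht Hj; rewrite Ttilde_eq by assumption; unfold That.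
assert (Hj1 : 1 <= INR j) by (change 1 with (INR 1); apply le_INR; lia).
assert (Hp : 0 < t ^ (2 * j - 1)) by (apply pow_lt; assumption).
replace (INR (2 * j - 1)) with (2 * INR j - 1)
  by (rewrite minus_INR, mult_INR by lia; simpl; ring).
replace (INR (2 * j)) with (2 * INR j) by (rewrite mult_INR; reflexivity).
rewrite Cpow_mult_l, <- RtoC_pow.
set (p := t ^ (2 * j - 1)) in *.
replace (2 * j - 1)%nat with (S (2 * (j - 1))) by lia.
cbn [Cpow]; rewrite Ci_pow_even.
set (sg := (-1) ^ (j - 1)).
assert (Hsg : sg * sg = 1)
  by (unfold sg; rewrite <- Rpow_mult_distr; replace (-1 * -1) with 1 by ring; apply pow1).
assert (Hb : Rabs (bernoulli (2 * j) (1 / 2)) = - sg * bernoulli (2 * j) (1 / 2)).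
{ destruct (bernoulli_signs j) as [_ H].
  replace ((-1) ^ j) with (- sg) in H
    by (unfold sg; replace j with (S (j - 1)) at 2 by lia; simpl; ring).
  rewrite <- (Rabs_pos_eq _ H), Rabs_mult, Rabs_Ropp.
  replace (Rabs sg) with 1; [ring|].
  assert (H1 := Rabs_pos sg).
  assert (H2 : Rabs sg * Rabs sg = 1) by (rewrite <- Rabs_mult, Hsg; apply Rabs_R1).
  nra. }
rewrite Hb; generalize (bernoulli (2 * j) (1 / 2)) as B; intros B.
clear Hb; clearbody sg p; set (x := INR j) in *; clearbody x.
set (d := 2 * x * (2 * x - 1) * p).
assert (Hd : 0 < d) by (unfold d; repeat apply Rmult_lt_0_compat; lra).
replace (RtoC (2 * x) * RtoC (2 * x - 1) * (Ci * RtoC sg * RtoC p))%C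
  with ((0, d * sg) : C) by (unfold d; apply injective_projections; simpl; ring).
assert (Hsg0 : sg <> 0) by nra.
replace (4 * x * (2 * x - 1) * p) with (2 * d) by (unfold d; ring).
transitivity (- B / (d * sg)); [simpl; field; lra|].
transitivity (- B * (sg * sg) / (d * sg)); [rewrite Hsg|]; field; lra.
Qed.

Lemma Im_sum_n_m (f : nat -> C) (n m : nat) :
  Im (sum_n_m f n m) = sum_n_m (fun j => Im (f j)) n m.
Proof.
destruct (le_lt_dec n m) as [Hnm|Hmn].
- induction Hnm as [|m Hnm IH]; [rewrite !sum_n_n; reflexivity|].
  rewrite !sum_n_Sm by lia; rewrite <- IH; reflexivity.
- rewrite !sum_n_m_zero by lia; reflexivity.
Qed.

Lemma Clog_imaginary (t : R) : 0 < t -> Clog (Ci * RtoC t) = (ln t, PI / 2).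
Proof.
intros Ht.
assert (E : (Ci * RtoC t)%C = (0, t)) by (apply injective_projections; simpl; ring).
rewrite E; unfold Clog, Carg.
assert (Hm : Cmod (0, t) = t).
{ unfold Cmod; simpl fst; simpl snd.
  replace (0 ^ 2 + t ^ 2) with (t ^ 2) by ring; apply sqrt_pow2; lra. }
rewrite Hm; simpl Im; simpl Re.
destruct (Rle_dec 0 t); [|lra].
unfold Rdiv at 1; rewrite Rmult_0_l, acos_0; reflexivity.
Qed.

Lemma Rtilde_eq (L : C -> C) (k : nat) (t : R) :
  0 < t ->
  Rtilde L k t = Im (L (1 / 2, t)) / 2 - (t * ln t - t) / 2
                 - sum_n_m (fun j => Ttilde j t) 1 (k - 1).
Proof.
intros Ht; unfold Rtilde, Rhat; rewrite Clog_imaginary by assumption.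
replace (Ci * RtoC t + RtoC (1 / 2))%C with ((1 / 2, t) : C)
  by (apply injective_projections; simpl; ring).
assert (Hs : Im (sum_n_m (fun j => That j (Ci * RtoC t)) 1 (k - 1))
             = 2 * sum_n_m (fun j => Ttilde j t) 1 (k - 1)).
{ rewrite Im_sum_n_m.
  rewrite (sum_n_m_ext_loc _ (fun j => mult 2 (Ttilde j t))).
  - apply (sum_n_m_mult_l 2 (fun j => Ttilde j t)).
  - intros j Hj; apply Im_That_imaginary; [assumption|lia]. }
set (s := sum_n_m _ 1 (k - 1)) in *.
set (r := sum_n_m _ 1 (k - 1)) in *.
clearbody s; destruct s as [s1 s2]; destruct (L _) as [l1 l2].
unfold Im in *; simpl in *; rewrite Hs; field.
Qed.

Theorem theorem5 (lnGamma : C -> C) (theta : R -> R)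
  (HlnGamma : is_lnGamma lnGamma) (Htheta : is_RS_theta theta) :
  forall (t : R) (k : nat), 0 < t -> (1 <= k)%nat ->
  theta t = t / 2 * ln (t / (2 * PI * exp 1)) - PI / 8
            + atan (exp (- PI * t)) / 2
            + sum_n_m (fun j => Ttilde j t) 1 (k - 1)
            + Rtilde lnGamma k t
  /\ forall j : nat, (1 <= j)%nat ->
     Ttilde j t = Rabs (bernoulli (2 * j) (1 / 2))
                  / (4 * INR j * (2 * INR j - 1) * t ^ (2 * j - 1)).
Proof.
intros t k Ht _; split; [|intros j Hj; apply Ttilde_eq; assumption].
assert (Hpi := PI_RGT_0); assert (He := exp_pos 1).
rewrite Rtilde_eq, (theta_lnGamma lnGamma theta HlnGamma Htheta) by lra.
rewrite ln_div, (ln_mult (2 * PI)), ln_exp by nra.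
field.
Qed.
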